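(* Let $\mathcal{Z}$ be a measurable space, $d:\mathcal{Z}\times\mathcal{Z}\to[0,\infty]$ a measurable function with $d(z,z)=0$ for all $z$, $\bm{l}:\mathcal{Z}\times\Theta\to\mathbb{R}$ a loss function, $\theta\in\Theta$, $\mathcal{Z}_N=\{Z^{(1)},\dots,Z^{(N)}\}\subset\mathcal{Z}$, and $\mathbb{P}_N=\sum_{i=1}^N\mu_i\bm{\chi}_{\{Z^{(i)}\}}$ a probability measure. Let $\operatorname{lb}_p$ and $\operatorname{cc}_p$ be as defined in the context. Then for all $1\le p\le p_2\le\infty$ and all $\epsilon>0$: (i) $\operatorname{lb}_1(\epsilon)\ge\operatorname{lb}_p(\epsilon)\ge\operatorname{lb}_{p_2}(\epsilon)\ge\operatorname{lb}_\infty(\epsilon)=\sum_{i=1}^N\mu_i\Delta_\theta(Z^{(i)},\epsilon)$; (ii) $\operatorname{cc}_1(\epsilon)\ge\operatorname{cc}_p(\epsilon)\ge\operatorname{cc}_{p_2}(\epsilon)\ge\operatorname{cc}_\infty(\epsilon)=\sum_{i=1}^N\mu_i\lim_{t\to\epsilon^+}\Delta_\theta(Z^{(i)},t)\ge\operatorname{lb}_\infty(\epsilon)$.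
   Context: Convention: $0\cdot\infty=0$; $\bm{\chi}_{\{z\}}$ is the Dirac mass at $z$. Individual rate: $\Delta_\theta(z,t)=\sup_{z'\in\mathcal{Z}}\{\bm{l}(z';\theta)-\bm{l}(z;\theta): d(z',z)\le t\}\in[0,\infty]$ for $t\ge0$. Maximal rate: $\Delta_\theta^{\max}(t)=\max_{Z^{(i)}\in\mathcal{Z}_N}\Delta_\theta(Z^{(i)},t)$. Majorants: a function on $[0,\infty)$ is concave if its hypograph $\{(x,y)\in[0,\infty)\times\mathbb{R}: y\le f(x)\}$ is convex; a function $f$ with $f(0)\ge0$ is star-shaped if its hypograph $H$ satisfies $\eta h\in H$ for all $h\in H$, $\eta\in[0,1]$. For a nonnegative $f$ on $[0,\infty)$, $\mathcal{C}_f(t)=\inf\{H(t): H\ge f,\ H\text{ concave}\}$ (least concave majorant) and $\mathcal{S}_f(t)=\inf\{H(t): H\ge f,\ H\text{ star-shaped}\}$ (least star-shaped majorant); all functions may take the value $+\infty$. Bounds: for $p<\infty$, $\operatorname{lb}_p(\epsilon)=\sum_{i=1}^N\mu_i\mathcal{S}_{f^{(i)}}(\epsilon^p)$ with $f^{(i)}(t)=\Delta_\theta(Z^{(i)},t^{1/p})$, and $\operatorname{cc}_p(\epsilon)=\mathcal{C}_{f^{\max}}(\epsilon^p)$ with $f^{\max}(t)=\Delta_\theta^{\max}(t^{1/p})$. For $p=\infty$, $\operatorname{lb}_\infty(\epsilon)=\sum_{i=1}^N\mu_i\Delta_\theta(Z^{(i)},\epsilon)$ and $\operatorname{cc}_\infty(\epsilon)=\sum_{i=1}^N\mu_i\lim_{t\to\epsilon^+}\Delta_\theta(Z^{(i)},t)$.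 *)

(* Defs.v *)
From HB Require Import structures.
From mathcomp Require Import all_boot all_order all_algebra.
From mathcomp Require Import all_classical all_reals all_analysis.

Set Implicit Arguments.
Unset Strict Implicit.
Unset Printing Implicit Defensive.

Import Order.TTheory GRing.Theory Num.Theory.
Import numFieldTopology.Exports numFieldNormedType.Exports.

Local Open Scope classical_set_scope.
Local Open Scope ring_scope.

(* A function on [0, +oo[ is represented by a function on the whole of R; all
   the notions below only look at its values at nonnegative arguments. *)
Section majorants.
Context {R : realType}.
Implicit Types f H : R -> \bar R.

(* The second coordinate is real, also when f takes infinite values. *)
Definition hypograph f : set (R^o * R^o) :=
  [set h | 0 <= h.1 /\ (h.2%:E <= f h.1)%E].

Definition concave f : Prop := convex_set (hypograph f).

Definition star_shaped f : Prop :=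
  (0 <= f 0%R)%E /\
  forall h (eta : R), hypograph f h -> 0 <= eta <= 1 -> hypograph f (eta *: h).

Definition majorizes H f : Prop := forall t, 0 <= t -> (f t <= H t)%E.

Definition concave_majorant f (t : R) : \bar R :=
  ereal_inf [set H t | H in [set H | majorizes H f /\ concave H]].

Definition star_majorant f (t : R) : \bar R :=
  ereal_inf [set H t | H in [set H | majorizes H f /\ star_shaped H]].

End majorants.

Section bounds.
Context {R : realType} {Z Theta : Type}.
Variables (d : Z * Z -> \bar R) (l : Z -> Theta -> R) (theta : Theta).

Definition rate (z : Z) (t : R) : \bar R :=
  ereal_sup [set (l z' theta - l z theta)%:E
            | z' in [set z' | (d (z', z) <= t%:E)%E]].

Variables (N : nat) (Zs : 'I_N -> Z) (mu : 'I_N -> R).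

(* The default value -oo only matters for N = 0. *)
Definition max_rate (t : R) : \bar R := \big[maxe/-oo%E]_(i < N) rate (Zs i) t.

(* The exponent ranges over [1, +oo]; the branch of +oo also catches -oo. *)
Definition lb (p : \bar R) (eps : R) : \bar R :=
  if p is r%:E then
    (\sum_(i < N) (mu i)%:E *
       star_majorant (fun t => rate (Zs i) (t `^ r^-1)%R) (eps `^ r)%R)%E
  else (\sum_(i < N) (mu i)%:E * rate (Zs i) eps)%E.

Definition cc (p : \bar R) (eps : R) : \bar R :=
  if p is r%:E then
    concave_majorant (fun t => max_rate (t `^ r^-1)) (eps `^ r)
  else (\sum_(i < N) (mu i)%:E * lim (rate (Zs i) t @[t --> eps^'+]))%E.

End bounds.

(* Main.v *)
(* If [p <= q] and [H] is a nonnegative concave (star-shaped) majorant of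
   [g (t `^ p^-1)], then [H (t `^ (p / q))] is a concave (star-shaped) majorant
   of [g (t `^ q^-1)], and its value at [eps `^ q] is [H (eps `^ p)]: this gives
   the monotonicity for finite exponents.  In the concave case one uses that a
   nonnegative concave function on [0, +oo[ is nondecreasing.  For [q = +oo],
   a majorant dominates [g eps], and by concavity it even dominates the right
   limit of [g] at [eps]; the weights [mu] sum to 1, so a common bound of the
   right limits of the individual rates bounds their weighted sum. *)
Require Import Defs.
From mathcomp Require Import all_boot all_order all_algebra.
From mathcomp Require Import all_classical all_reals all_analysis measurable_realfun.
From mathcomp Require Import ring lra.

Set Implicit Arguments.
Unset Strict Implicit.

Import Order.TTheory GRing.Theory Num.Theory.
Import numFieldTopology.Exports numFieldNormedType.Exports.

Local Open Scope classical_set_scope.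
Local Open Scope ring_scope.

(** Hypographs have a real second coordinate, so possibly infinite values are compared through their
    real lower bounds. *)
Lemma le_ereal_real (R : realType) (x y : \bar R) :
  (forall r : R, r%:E <= x -> r%:E <= y)%E -> (x <= y)%E.
Proof.
case: x => [r||]; first exact; last by rewrite leNye.
rewrite ?leye_eq; case: y => [s|//|] H.
  by have := H (s + 1) (leey _); rewrite lee_fin gerDl ler10.
by have := H 0 (leey _).
Qed.

(** * Concave and star-shaped functions under powers of the argument *)

Section hypographs.
Context {R : realType}.
Implicit Types (H : R -> \bar R) (b s t x y k : R).

(** [convex_set] takes coefficients bundled in [{i01 R}]; here [k] is a plain real, as the chord
    arguments need. *)
Lemma concaveP H : concave H <->
  forall x1 y1 x2 y2 k, 0 <= x1 -> 0 <= x2 ->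
    (y1%:E <= H x1)%E -> (y2%:E <= H x2)%E -> 0 <= k <= 1 ->
    ((k * y1 + (1 - k) * y2)%:E <= H (k * x1 + (1 - k) * x2)%R)%E.
Proof.
split=> [cH x1 y1 x2 y2 k x10 x20 H1 H2 /andP[k0 k1]|cH].
  have [l lk] : exists l : {i01 R}, l%:num = k by exists (Itv01 k0 k1).
  have := cH (x1, y1) (x2, y2) l.
  rewrite !inE /hypograph /= => /(_ (conj x10 H1) (conj x20 H2))[_].
  by rewrite -lk.
move=> [x1 y1] [x2 y2] l; rewrite !inE => -[/= x10 H1] [/= x20 H2].
have l0 : 0 <= l%:num by [].
have l1 : l%:num <= 1 by [].
split=> /=; last by apply: cH => //; apply/andP.
by apply: addr_ge0; apply: mulr_ge0 => //; rewrite subr_ge0.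
Qed.

Lemma star_shapedP H : star_shaped H <->
  (0 <= H 0%R)%E /\ forall x y k, 0 <= x -> (y%:E <= H x)%E -> 0 <= k <= 1 ->
    ((k * y)%:E <= H (k * x)%R)%E.
Proof.
split=> -[H0 sH]; split=> //.
  by move=> x y k x0 yH k01; have [] := sH (x, y) k (conj x0 yH) k01.
move=> [x y] k [/= x0 yH] k01; split => /=; last exact: sH.
by apply: mulr_ge0 => //; case/andP: k01.
Qed.

(** The second endpoint of the chord is the origin, which lies in the hypograph because
    [0 <= H 0]. *)
Lemma concave_star_shaped H : (0 <= H 0%R)%E -> concave H -> star_shaped H.
Proof.
move=> H0 /concaveP cH; apply/star_shapedP; split=> // x y k x0 yH k01.
by have := cH _ _ _ _ _ x0 (lexx 0) yH H0 k01; rewrite !mulr0 !addr0.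
Qed.

(* Otherwise a chord from [(s, H s)] would bring [H] below 0 far to the right. *)
Lemma concave_nondecreasing H : (forall t : R, 0 <= t -> (0 <= H t)%E) ->
  concave H -> forall s t, 0 <= s -> s <= t -> (H s <= H t)%E.
Proof.
move=> H0 /concaveP cH s t s0 st; apply: le_ereal_real => y yH.
have t0 := le_trans s0 st.
have [y0|y0] := leP y 0; first by rewrite (le_trans _ (H0 _ t0))// lee_fin.
move: st; rewrite le_eqVlt => /predU1P[<-//|st].
(* The chord from [(s, y)] to [(M, 0)], read at [t]; its right end is in the hypograph since [H] is
   nonnegative. *)
have {}cH M : t < M -> (((M - t) / (M - s) * y)%:E <= H t)%E.
  move=> tM; have sM := lt_trans st tM.
  have Ms : 0 < M - s by rewrite subr_gt0.
  have M0 : 0 <= M by rewrite (le_trans t0)// ltW.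
  have := cH _ _ _ _ ((M - t) / (M - s)) s0 M0 yH (H0 _ M0).
  rewrite mulr0 addr0.
  have -> : (M - t) / (M - s) * s + (1 - (M - t) / (M - s)) * M = t.
    by field; rewrite gt_eqF.
  apply; rewrite divr_ge0 ?subr_ge0 ?(ltW tM) ?(ltW sM)//=.
  by rewrite ler_pdivrMr// mul1r lerD2l lerN2 ltW.
case Ht : (H t) => [h||]; last 2 first.
- by rewrite leey.
- by have := H0 _ t0; rewrite Ht.
have h0 : 0 <= h by have := H0 _ t0; rewrite Ht lee_fin.
rewrite lee_fin leNgt; apply/negP => hy.
(* [a * y] is the midpoint of [y] and [h], hence above [h]; [M] solves [(M - t) / (M - s) = a]. *)
pose a := (y + h) / (y *+ 2).
pose M := (t - a * s) / (1 - a).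
have yh0 : 0 < y + h by rewrite ltr_wpDr.
have yy0 : 0 < y *+ 2 by rewrite pmulrn_lgt0.
have a0 : 0 < a by rewrite divr_gt0.
have a1 : 0 < 1 - a by rewrite subr_gt0 ltr_pdivrMr// mul1r mulr2n ltrD2l.
have MtE : M - t = a * (t - s) / (1 - a) by rewrite /M; field; rewrite gt_eqF.
have MsE : M - s = (t - s) / (1 - a) by rewrite /M; field; rewrite gt_eqF.
have tM : t < M by rewrite -subr_gt0 MtE divr_gt0// mulr_gt0// subr_gt0.
have := cH M tM; rewrite Ht lee_fin MtE MsE.
have -> : a * (t - s) / (1 - a) / ((t - s) / (1 - a)) = a.
  by field; rewrite gt_eqF// gt_eqF// subr_gt0.
have -> : a * y = (y + h) / 2.
  by rewrite /a; field; rewrite gt_eqF.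
lra.
Qed.

(** On [0, 1] the [b]-th power of [k] is at least [k], so star-shapedness of [H] with that power as
    factor suffices when [y] is positive. *)
Lemma star_shaped_powR H b : (forall t : R, 0 <= t -> (0 <= H t)%E) ->
  0 < b <= 1 -> star_shaped H -> star_shaped (fun t => H (t `^ b)).
Proof.
move=> H0 /andP[b0 b1] /star_shapedP[H00 sH].
apply/star_shapedP; split; first by rewrite H0 ?powR_ge0.
move=> x y k x0 yH /andP[k0 k1].
(* For [y <= 0] multiplying by [y] would reverse that comparison; nonnegativity of [H] settles this
   case. *)
have [y0|y0] := leP y 0.
  by rewrite (le_trans _ (H0 _ (powR_ge0 _ _)))// lee_fin mulr_ge0_le0.
rewrite powRM//.
have kb1 : k `^ b <= 1.
  by have := ge0_ler_powR (ltW b0) k0 ler01 k1; rewrite powR1.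
have := sH _ _ (k `^ b) (powR_ge0 _ _) yH; rewrite powR_ge0 kb1 => /(_ isT).
apply: le_trans; rewrite lee_fin ler_wpM2r ?(ltW y0)//.
have [->|kN0] := eqVneq k 0; first exact: powR_ge0.
by rewrite ger1_powR// lt_def kN0 k0.
Qed.

(** Convexity of the power with exponent [b^-1 >= 1], applied to the [b]-th powers of [x1] and [x2],
    followed by a [b]-th power on both sides. *)
Lemma powR_concave b x1 x2 k : 0 < b <= 1 -> 0 <= x1 -> 0 <= x2 ->
  0 <= k <= 1 ->
  k * x1 `^ b + (1 - k) * x2 `^ b <= (k * x1 + (1 - k) * x2) `^ b.
Proof.
move=> /andP[b0 b1] x10 x20 /andP[k0 k1].
have bV1 : 1 <= b^-1 by rewrite invf_ge1.
have pos x : x `^ b \in [set` `[0, +oo[%R] by rewrite inE/= in_itv/= powR_ge0.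
set u := k * x1 `^ b + _; set v := k * x1 + _.
have uv : u `^ b^-1 <= v.
  have : u `^ b^-1 <= k * (x1 `^ b) `^ b^-1 + (1 - k) * (x2 `^ b) `^ b^-1.
    exact: (convex_powR bV1 (Itv01 k0 k1) (pos x1) (pos x2)).
  by rewrite -!powRrM mulfV ?gt_eqF// !powRr1.
have k10 : 0 <= 1 - k by rewrite subr_ge0.
have u0 : 0 <= u by rewrite addr_ge0// mulr_ge0// powR_ge0.
have v0 : 0 <= v by rewrite addr_ge0// mulr_ge0.
have := ge0_ler_powR (ltW b0) (powR_ge0 u b^-1) v0 uv.
by rewrite -powRrM mulVf ?gt_eqF// powRr1.
Qed.

(** Concavity of [H] gives the bound at the mean of the powers; monotonicity carries it to the
    larger power of the mean. *)
Lemma concave_powR H b : (forall t : R, 0 <= t -> (0 <= H t)%E) ->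
  0 < b <= 1 -> concave H -> concave (fun t => H (t `^ b)).
Proof.
move=> H0 b01 cH; have Hnd := concave_nondecreasing H0 cH.
move/concaveP : cH => cH; apply/concaveP => x1 y1 x2 y2 k x10 x20 H1 H2 k01.
have := cH _ _ _ _ _ (powR_ge0 _ _) (powR_ge0 _ _) H1 H2 k01.
move=> /le_trans; apply; apply: Hnd; last exact: powR_concave.
by case/andP: k01 => k0 k1; rewrite addr_ge0// mulr_ge0 ?powR_ge0 ?subr_ge0.
Qed.

End hypographs.

(** * Comparison of majorants for two exponents *)

Section majorants_powR.
Context {R : realType}.
Variable g : R -> \bar R.
Hypothesis g_ge0 : forall t : R, 0 <= t -> (0 <= g t)%E.
Variables p q e : R.
Hypotheses (p_gt0 : 0 < p) (pq : p <= q) (e_ge0 : 0 <= e).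

Let q_gt0 : 0 < q. Proof. exact: lt_le_trans p_gt0 pq. Qed.

Let pq01 : 0 < p / q <= 1.
Proof. by rewrite divr_gt0//= ler_pdivrMr// mul1r. Qed.

Let majorizes_ge0 H r : majorizes H (fun t => g (t `^ r)) ->
  forall t : R, 0 <= t -> (0 <= H t)%E.
Proof.
by move=> + t t0 => /(_ _ t0); apply: le_trans; rewrite g_ge0 ?powR_ge0.
Qed.

Let majorizes_powR H : majorizes H (fun t => g (t `^ p^-1)) ->
  majorizes (fun t => H (t `^ (p / q))) (fun t => g (t `^ q^-1)).
Proof.
move=> mH t t0; have := mH _ (powR_ge0 t (p / q)).
by rewrite -powRrM (_ : p / q / p = q^-1)//; field; rewrite !gt_eqF.
Qed.

Let powR_powR_div : (e `^ q) `^ (p / q) = e `^ p.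
Proof. by rewrite -powRrM; congr (_ `^ _); field; rewrite gt_eqF. Qed.

Lemma le_star_majorant_powR :
  (star_majorant (fun t => g (t `^ q^-1)) (e `^ q) <=
   star_majorant (fun t => g (t `^ p^-1)) (e `^ p))%E.
Proof.
apply: le_ereal_inf_tmp => _ [H [mH sH] <-].
apply: ge_ereal_inf; exists (H (e `^ p)) => //.
exists (fun t => H (t `^ (p / q))); last by rewrite powR_powR_div.
split; first exact: majorizes_powR.
exact: star_shaped_powR (majorizes_ge0 mH) pq01 sH.
Qed.

Lemma le_concave_majorant_powR :
  (concave_majorant (fun t => g (t `^ q^-1)) (e `^ q) <=
   concave_majorant (fun t => g (t `^ p^-1)) (e `^ p))%E.
Proof.
apply: le_ereal_inf_tmp => _ [H [mH cH] <-].
apply: ge_ereal_inf; exists (H (e `^ p)) => //.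
exists (fun t => H (t `^ (p / q))); last by rewrite powR_powR_div.
split; first exact: majorizes_powR.
exact: concave_powR (majorizes_ge0 mH) pq01 cH.
Qed.

Lemma le_star_majorant :
  (g e <= star_majorant (fun t => g (t `^ q^-1)) (e `^ q))%E.
Proof.
apply: le_ereal_inf_tmp => _ [H [mH _] <-].
have := mH _ (powR_ge0 e q).
by rewrite -powRrM mulfV ?gt_eqF// powRr1.
Qed.

(* A star-shaped [H] satisfies [H (k t) <= k H t] for [k >= 1], so it is bounded
   below by the right limits of the functions that it majorizes. *)
Lemma le_concave_majorant_right (a : \bar R) : 0 < e ->
  (forall u, e < u -> (a <= g u)%E) ->
  (a <= concave_majorant (fun t => g (t `^ q^-1)) (e `^ q))%E.
Proof.
move=> e_gt0 ag; apply: le_ereal_inf_tmp => _ [H [mH cH] <-].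
have H0 := majorizes_ge0 mH.
have /star_shapedP[_ sH] := concave_star_shaped (H0 _ (lexx _)) cH.
apply: le_ereal_real => y ya.
have eq0 : 0 < e `^ q by rewrite powR_gt0.
(* At [k] times the [q]-th power of [e], whose [q]-th root exceeds [e], [H] is at least [y]; the
   factor [k^-1] leads back to the power itself. *)
have {}sH k : 1 < k -> ((k^-1 * y)%:E <= H (e `^ q)%R)%E.
  move=> k1; have k0 := lt_trans ltr01 k1.
  have keq0 : 0 <= k * e `^ q by rewrite mulr_ge0 ?ltW.
  have := sH (k * e `^ q) y k^-1 keq0.
  rewrite mulrA mulVf ?gt_eqF// mul1r; apply; last first.
    by rewrite invr_ge0 (ltW k0) invf_le1// ltW.
  apply: (le_trans ya); apply: le_trans (mH _ keq0).
  apply: ag; rewrite powRM ?(ltW k0) ?(ltW eq0)//.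
  rewrite -powRrM mulfV ?gt_eqF// powRr1//.
  rewrite ltr_pMl//.
  have := @gt0_ltr_powR R q^-1 _ 1 k; rewrite powR1; apply => //.
  - by rewrite invr_gt0.
  - by rewrite nnegrE.
  - by rewrite nnegrE ltW.
case Ht : (H (e `^ q)) sH => [h||] sH; last 2 first.
- by rewrite leey.
- by have := H0 _ (ltW eq0); rewrite Ht.
have h0 : 0 <= h by have := H0 _ (ltW eq0); rewrite Ht lee_fin.
rewrite lee_fin leNgt; apply/negP => hy.
have y0 : 0 < y by exact: le_lt_trans hy.
have yh0 : 0 < y + h by rewrite ltr_wpDr.
(* This factor exceeds 1 because [h < y]; dividing [y] by it gives the midpoint of [y] and [h],
   which is above [h]. *)
have := sH (y *+ 2 / (y + h)); rewrite ltr_pdivlMr// mul1r mulr2n ltrD2l.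
move=> /(_ hy); rewrite lee_fin.
have -> : ((y + y) / (y + h))^-1 * y = (y + h) / 2.
  by field; rewrite !gt_eqF//= ?addr_gt0.
lra.
Qed.

End majorants_powR.

(** * Rates and the bounds built from them *)

Section rates.
Context {R : realType} {Z Theta : Type}.
Variables (d : Z * Z -> \bar R) (l : Z -> Theta -> R) (theta : Theta).
Hypothesis d_diag : forall z, d (z, z) = 0%E.

Lemma rate_ge0 z (t : R) : 0 <= t -> (0 <= rate d l theta z t)%E.
Proof.
move=> t0; apply: ereal_sup_ubound; exists z => /=; last by rewrite subrr.
by rewrite d_diag lee_fin.
Qed.

Lemma rate_nondecreasing z (s t : R) : s <= t ->
  (rate d l theta z s <= rate d l theta z t)%E.
Proof.
move=> st; apply: ereal_sup_le => _ [z' /= dz <-]; exists z' => //=.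
by rewrite (le_trans dz)// lee_fin.
Qed.

(** Monotonicity of the rate makes the [lim] in [cc] a genuine limit rather than a default value. *)
Lemma is_cvg_rate_right z (t : R) : cvg (rate d l theta z u @[u --> t^'+]).
Proof.
apply: nondecreasing_at_right_is_cvge; apply: nearW => x a b _ _.
exact: rate_nondecreasing.
Qed.

Lemma rate_le_lim z (t : R) :
  (rate d l theta z t <= lim (rate d l theta z u @[u --> t^'+]))%E.
Proof.
apply: lime_ge; first exact: is_cvg_rate_right.
near=> u; apply: rate_nondecreasing.
by near: u; exact: nbhs_right_ge.
Unshelve. all: by end_near. Qed.

Lemma lim_rate_le z (t u : R) : t < u ->
  (lim (rate d l theta z v @[v --> t^'+]) <= rate d l theta z u)%E.
Proof.
move=> tu; apply: lime_le; first exact: is_cvg_rate_right.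
near=> v; apply: rate_nondecreasing.
by near: v; exact: nbhs_right_ltW.
Unshelve. all: by end_near. Qed.

Variables (N : nat) (Zs : 'I_N -> Z) (mu : 'I_N -> R).
Hypothesis mu_ge0 : forall i, 0 <= mu i.
Hypothesis mu_sum1 : \sum_(i < N) mu i = 1.
Variable eps : R.
Hypothesis eps_gt0 : 0 < eps.

Lemma rate_le_max_rate i (t : R) :
  (rate d l theta (Zs i) t <= max_rate d l theta Zs t)%E.
Proof. by rewrite /max_rate (bigD1 i)//= le_max lexx. Qed.

Lemma max_rate_ge0 (t : R) : 0 <= t -> (0 <= max_rate d l theta Zs t)%E.
Proof.
move=> t0; case: (pickP (fun _ : 'I_N => true)) => [i _|noI].
  exact: le_trans (rate_ge0 (Zs i) t0) (rate_le_max_rate i t).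
(* With no index the weights would sum to 0; this excludes the default [-oo] of the maximum. *)
by move: mu_sum1; rewrite big_pred0// => /esym/eqP; rewrite oner_eq0.
Qed.

Lemma lb_nonincreasing (p q : \bar R) : (1 <= p)%E -> (p <= q)%E ->
  (lb d l theta Zs mu q eps <= lb d l theta Zs mu p eps)%E.
Proof.
case: p => [p| |] // p1; case: q => [q| |] // pq; rewrite /lb.
- apply: lee_sum => i _; apply: lee_wpmul2l; first by rewrite lee_fin.
  rewrite !lee_fin in p1 pq.
  apply: (@le_star_majorant_powR _ (rate d l theta (Zs i))) => //.
  + by move=> t; exact: rate_ge0.
  + exact: lt_le_trans p1.
- apply: lee_sum => i _; apply: lee_wpmul2l; first by rewrite lee_fin.
  rewrite lee_fin in p1.
  (* The smaller exponent of the comparison is taken to be 1, the larger one is [p]. *)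
  by apply: (@le_star_majorant _ (rate d l theta (Zs i)) 1) => //; exact: ltW.
Qed.

Lemma sum_mu_le (x : 'I_N -> \bar R) (M : \bar R) :
  (forall i, 0 <= x i)%E -> (forall i, x i <= M)%E ->
  (\sum_(i < N) (mu i)%:E * x i <= M)%E.
Proof.
move=> x0 xM; apply: (@le_trans _ _ (\sum_(i < N) (mu i)%:E * M)%E).
  by apply: lee_sum => i _; apply: lee_wpmul2l; rewrite ?lee_fin.
(* [M] may be infinite; nonnegative weights justify factoring it out. *)
rewrite -ge0_sume_distrl; last by move=> i _; rewrite lee_fin.
by rewrite sumEFin mu_sum1 mul1e.
Qed.

Lemma cc_nonincreasing (p q : \bar R) : (1 <= p)%E -> (p <= q)%E ->
  (cc d l theta Zs mu q eps <= cc d l theta Zs mu p eps)%E.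
Proof.
case: p => [p| |] // p1; case: q => [q| |] // pq; rewrite /cc.
- rewrite !lee_fin in p1 pq.
  apply: (@le_concave_majorant_powR _ (max_rate d l theta Zs)) => //.
  + by move=> t; exact: max_rate_ge0.
  + exact: lt_le_trans p1.
- rewrite lee_fin in p1; apply: sum_mu_le => i.
    exact: le_trans (rate_ge0 _ (ltW eps_gt0)) (rate_le_lim _ _).
  (* The right limit of each rate at [eps] is at most [max_rate] at every [u > eps]. *)
  apply: (@le_concave_majorant_right _ (max_rate d l theta Zs) _ 1) => //.
  + by move=> t; exact: max_rate_ge0.
  + exact: ltW.
  + by move=> u /lim_rate_le /le_trans; apply; exact: rate_le_max_rate.
Qed.

Lemma lb_le_cc_pinfty :
  (lb d l theta Zs mu +oo eps <= cc d l theta Zs mu +oo eps)%E.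
Proof.
apply: lee_sum => i _; apply: lee_wpmul2l; first by rewrite lee_fin.
exact: rate_le_lim.
Qed.

End rates.

Theorem corollary1 (R : realType) (disp : measure_display)
    (Z : measurableType disp) (Theta : Type)
    (d : Z * Z -> \bar R)
    (d_meas : measurable_fun [set: Z * Z] d)
    (d_ge0 : forall zz, (0 <= d zz)%E)
    (d_diag : forall z, d (z, z) = 0%E)
    (l : Z -> Theta -> R) (theta : Theta)
    (N : nat) (Zs : 'I_N -> Z) (mu : 'I_N -> R)
    (mu_ge0 : forall i, 0 <= mu i)
    (PN : probability Z R)
    (PN_def : forall A : set Z, measurable A ->
       PN A = (\sum_(i < N) (mu i)%:E * \d_(Zs i) A)%E)
    (p p2 : \bar R) (hp : (1 <= p)%E) (hp2 : (p <= p2)%E)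
    (eps : R) (heps : 0 < eps) :
  [/\ (lb d l theta Zs mu 1 eps >= lb d l theta Zs mu p eps)%E,
      (lb d l theta Zs mu p eps >= lb d l theta Zs mu p2 eps)%E,
      (lb d l theta Zs mu p2 eps >= lb d l theta Zs mu +oo eps)%E
    & lb d l theta Zs mu +oo%E eps
        = (\sum_(i < N) (mu i)%:E * rate d l theta (Zs i) eps)%E]
  /\
  [/\ (cc d l theta Zs mu 1 eps >= cc d l theta Zs mu p eps)%E,
      (cc d l theta Zs mu p eps >= cc d l theta Zs mu p2 eps)%E,
      (cc d l theta Zs mu p2 eps >= cc d l theta Zs mu +oo eps)%E,
      cc d l theta Zs mu +oo%E eps
        = (\sum_(i < N) (mu i)%:E *
             lim (rate d l theta (Zs i) t @[t --> eps^'+]))%E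
    & (cc d l theta Zs mu +oo%E eps >= lb d l theta Zs mu +oo%E eps)%E].
Proof.
(* Evaluate [PN] on the whole space, where every Dirac mass equals 1. *)
have mu_sum1 : \sum_(i < N) mu i = 1.
  have := PN_def _ measurableT; rewrite probability_setT.
  under eq_bigr do rewrite diracT mule1.
  by rewrite sumEFin => -[].
split; split=> //; do ?[exact: lb_nonincreasing|exact: cc_nonincreasing].
- by apply: lb_nonincreasing => //; rewrite ?(le_trans hp hp2) ?leey.
- by apply: cc_nonincreasing => //; rewrite ?(le_trans hp hp2) ?leey.
- exact: lb_le_cc_pinfty.
Qed.
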